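(* Let $\alpha>0$, let $\{M(t)\}_{t\ge0}$ be a generalized counting process with positive rates $\lambda_1,\dots,\lambda_k$, $\Lambda=\lambda_1+\cdots+\lambda_k$, and let $$\mathcal{M}^\alpha(t)=\frac1{\Gamma(\alpha)}\int_0^t(t-s)^{\alpha-1}M(s)\,\mathrm{d}s.$$ Then, for $t>0$ and $n\ge0$, $$\mathbb{E}(\mathcal{M}^\alpha(t)\mid M(t)=n)=\frac1{\Gamma(\alpha)}\sum_{r=0}^n\frac{r\,e^{-\Lambda t}}{\Pr\{M(t)=n\}}\sum_{\Omega(k,r)}\Big(\prod_{j=1}^k\frac{\lambda_j^{y_j}}{y_j!}\Big)\sum_{\Omega(k,n-r)}\Big(\prod_{j=1}^k\frac{\lambda_j^{z_j}}{z_j!}\Big)t^{y+\alpha+z}B(y+1,\alpha+z),$$ where $y=y_1+y_2+\cdots+y_k$ and $z=z_1+z_2+\cdots+z_k$.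
   Context: Generalized counting process (GCP): for $k\ge1$ and $\lambda_1,\dots,\lambda_k>0$, it is the non-negative integer valued Lévy process $\{M(t)\}_{t\ge0}$, $M(0)=0$, with $\Pr\{M(t+h)=n+j\mid M(t)=n\}=1-\Lambda h+o(h)$ for $j=0$, $=\lambda_jh+o(h)$ for $1\le j\le k$, $=o(h)$ for $j\ge k+1$, where $\Lambda=\sum_{j=1}^k\lambda_j$. Equivalently $\mathbb{E}(u^{M(t)})=\exp(-t\sum_{j=1}^k\lambda_j(1-u^j))$ for $|u|\le1$. $\Omega(k,m)=\{(x_1,\dots,x_k)\in\mathbb{N}_0^k:\sum_{j=1}^kjx_j=m\}$, $\mathbb{N}_0$ the non-negative integers; the sum over $\Omega(k,r)$ is over tuples $(y_1,\dots,y_k)$ and the (nested) sum over $\Omega(k,n-r)$ is over tuples $(z_1,\dots,z_k)$. $B(a,b)=\int_0^1u^{a-1}(1-u)^{b-1}\,\mathrm{d}u$ is the beta function. *)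

(* Defs.v *)
From HB Require Import structures.
From mathcomp Require Import all_boot all_order all_algebra.
From mathcomp Require Import all_classical all_reals all_analysis.

Set Implicit Arguments.
Unset Strict Implicit.
Unset Printing Implicit Defensive.

Import Order.TTheory GRing.Theory Num.Theory.
Import numFieldNormedType.Exports.

Local Open Scope classical_set_scope.
Local Open Scope ring_scope.

Section special_functions.
Context {R : realType}.
Notation mu := (@lebesgue_measure R).

(* Meaningful for 0 < a (resp. 0 < a and 0 < b); the values of the integrands
   at the endpoints, where [powR] is total, do not matter. *)
Definition Gamma (a : R) : R :=
  \int[mu]_(x in `[0, +oo[) (x `^ (a - 1) * expR (- x)).

Definition Beta (a b : R) : R :=
  \int[mu]_(u in `[0, 1]) (u `^ (a - 1) * (1 - u) `^ (b - 1)).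

End special_functions.

(* The coordinate x_j, 1 <= j <= k, is [x i] with j = i.+1. *)
Definition Omega (k m : nat) : set {ffun 'I_k -> nat} :=
  [set x | (\sum_(i < k) i.+1 * x i)%N = m].
Arguments Omega : clear implicits.

(* A finitely supported sum over an infinite set would be 0 by convention, so
   this lemma is what makes sums over [Omega k m] genuine finite sums. *)
Lemma finite_Omega (k m : nat) : finite_set (Omega k m).
Proof.
pose g (f : {ffun 'I_k -> 'I_m.+1}) : {ffun 'I_k -> nat} :=
  [ffun i => nat_of_ord (f i)].
apply: (@sub_finite_set _ _ (range g)); last exact: finite_image.
move=> x xm; exists [ffun i => inord (x i)] => //.
apply/ffunP => i; rewrite !ffunE inordK// ltnS.
by rewrite -xm (bigD1 i)//= mulSn -addnA leq_addr.
Qed.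

Section conditioning.
Context {d : measure_display} {T : measurableType d} {R : realType}.
Variable P : probability T R.

(* Both are meaningful only when [P B != 0]. *)
Definition cond_prob (A B : set T) : R := fine (P (A `&` B)) / fine (P B).

Definition cond_expectation (X : T -> R) (B : set T) : \bar R :=
  ((fine (P B))^-1%:E * \int[P]_(w in B) (X w)%:E)%E.

End conditioning.

Section processes.
Context {d : measure_display} {T : measurableType d} {R : realType}.
Variable P : probability T R.

(* Mutual independence of a finite family; subfamilies are covered by taking
   [B i = setT]. *)
Definition mutually_independent (n : nat) (Y : 'I_n -> T -> R) : Prop :=
  forall B : 'I_n -> set R, (forall i, measurable (B i)) ->
    P (\bigcap_(i in [set: 'I_n]) (Y i @^-1` B i)) =
    (\prod_(i < n) P (Y i @^-1` B i))%E.

Definition cadlag (f : R -> R) : Prop :=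
  (forall t, 0 <= t -> f s @[s --> t^'+] --> f t) /\
  (forall t, 0 < t -> cvg (f s @[s --> t^'-])).

(* The time axis is [0, +oo[: values of [X] at negative times are never
   constrained. *)
Record Levy_process (X : R -> T -> R) : Prop := {
  Levy_measurable : forall t, 0 <= t -> measurable_fun [set: T] (X t) ;
  Levy_start : {ae P, forall w, X 0 w = 0} ;
  Levy_independent_increments : forall (n : nat) (t : nat -> R),
    0 <= t 0%N -> (forall i, (i < n)%N -> t i < t i.+1) ->
    mutually_independent (fun (i : 'I_n) w => X (t i.+1) w - X (t i) w) ;
  Levy_stationary_increments : forall (s h : R) (B : set R),
    0 <= s -> 0 <= h -> measurable B ->
    P ((fun w => X (s + h) w - X s w) @^-1` B) =
    P ((fun w => X h w - X 0 w) @^-1` B) ;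
  Levy_stochastically_continuous : forall t e : R, 0 <= t -> 0 < e ->
    P [set w | e < `|X s w - X t w|]
      @[s --> within [set s | 0 <= s] (nbhs t)] --> 0%E ;
  Levy_cadlag : {ae P, forall w, cadlag (X ^~ w)} }.

(* The rate lambda_j, 1 <= j <= k, is [lam i] with j = i.+1. *)
Definition total_rate (k : nat) (lam : 'I_k -> R) : R := \sum_(i < k) lam i.

Record GCP (k : nat) (lam : 'I_k -> R) (M : R -> {RV P >-> nat}) : Prop := {
  GCP_Levy : Levy_process (fun t w => (M t w)%:R) ;
  GCP_stay : forall (t : R) (n : nat),
    0 <= t -> P (M t @^-1` [set n]) != 0%E ->
    (fun h : R => cond_prob P (M (t + h) @^-1` [set n]) (M t @^-1` [set n])
                  - (1 - total_rate lam * h))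
      =o_ (0^'+) (fun h : R => h) ;
  GCP_jump : forall (t : R) (n : nat) (i : 'I_k),
    0 <= t -> P (M t @^-1` [set n]) != 0%E ->
    (fun h : R => cond_prob P (M (t + h) @^-1` [set (n + i.+1)%N])
                    (M t @^-1` [set n]) - lam i * h)
      =o_ (0^'+) (fun h : R => h) ;
  GCP_large_jump : forall (t : R) (n j : nat),
    0 <= t -> P (M t @^-1` [set n]) != 0%E -> (k < j)%N ->
    (fun h : R => cond_prob P (M (t + h) @^-1` [set (n + j)%N])
                    (M t @^-1` [set n]))
      =o_ (0^'+) (fun h : R => h) }.

Definition fractional_integral (a : R) (M : R -> T -> nat) (t : R) (w : T) : R :=
  (Gamma a)^-1 *
  \int[@lebesgue_measure R]_(s in `[0, t]) ((t - s) `^ (a - 1) * (M s w)%:R).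

End processes.

(* Main.v *)
(* The law of M(t) is identified from the infinitesimal rates as follows: both
   n |-> Pr{M(t) = n} and its compound Poisson candidate are convolution
   semigroups, truncated at n they are power-bounded, and they differ by o(h) at
   time h; writing t = m h and telescoping gives equality.  Independent and
   stationary increments then give, for 0 < s < t,
     E(M(s); M(t) = n) = sum_r r Pr{M(s) = r} Pr{M(t - s) = n - r},
   Tonelli's theorem (the paths are a.s. right continuous, hence M is jointly
   measurable up to a null set) moves the expectation inside the fractional
   integral, and each remaining integral of s^y (t - s)^(alpha + z - 1) is a
   scaled beta integral. *)

Require Import Defs.
From HB Require Import structures.
From mathcomp Require Import all_boot all_order all_algebra.
From mathcomp Require Import all_classical all_reals all_analysis.
From mathcomp Require Import measurable_realfun ring.

Set Implicit Arguments.
Unset Strict Implicit.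
Unset Printing Implicit Defensive.

Import Order.TTheory GRing.Theory Num.Theory.
Import numFieldNormedType.Exports.

Local Open Scope classical_set_scope.
Local Open Scope ring_scope.

(** * Convolution semigroups *)

(** Telescoping over [m.+1] steps of length [h = t / m.+1]. Convolution with [p h] does not enlarge
    an earlier error, because its absolute mass is at most 1; exchanging [p h] for [q h] costs at
    most [e * h] per coefficient, times the bound [C] on [q]. The total error is proportional to
    [e * t], with [e] arbitrary. *)
Lemma convolution_semigroup_eq {R : realType} (n : nat) (p q : R -> nat -> R)
    (C t : R) :
  (forall s h i, 0 < s -> 0 < h -> (i <= n)%N ->
    p (s + h) i = \sum_(j < i.+1) p h j * p s (i - j)%N) ->
  (forall s h i, 0 < s -> 0 < h -> (i <= n)%N ->
    q (s + h) i = \sum_(j < i.+1) q h j * q s (i - j)%N) ->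
  (forall h i, 0 < h -> (i <= n)%N -> \sum_(j < i.+1) `|p h j| <= 1) ->
  (forall h i, 0 < h <= t -> (i <= n)%N -> `|q h i| <= C) ->
  (forall i, (i <= n)%N -> forall e, 0 < e ->
    \forall h \near 0^'+, `|p h i - q h i| <= e * h) ->
  0 < t -> forall i, (i <= n)%N -> p t i = q t i.
Proof.
move=> pD qD p1 qC pq t0 i lin.
have C0 : 0 <= C by apply: le_trans (qC t i _ lin); rewrite ?t0 ?lexx.
(* One step adds at most [n.+1] terms of size [e * h * C]; the summand 1 covers the very first step,
   where the error is [e * h]. *)
pose K := 1 + n.+1%:R * C.
have K1 : 1 <= K by rewrite lerDl mulr_ge0.
have K0 : 0 < K by rewrite (lt_le_trans ltr01).
suff main e : 0 < e -> `|p t i - q t i| <= e * K * t.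
  apply/eqP; rewrite -subr_eq0 -normr_eq0 eq_le normr_ge0 andbT.
  apply/ler_addgt0Pl => e e0; rewrite addr0.
  have := main (e / (K * t)); rewrite -mulrA divfK.
    by apply; rewrite divr_gt0// mulr_gt0.
  by rewrite mulf_neq0// gt_eqF.
move=> e0.
have [d /= d0 {}pq] : \forall h \near 0^'+, forall j : 'I_n.+1,
    `|p h j - q h j| <= e * h.
  by apply: filter_forall => j; apply: pq; rewrite // -ltnS.
(* The mesh must fall below [d], the common range in which the first-order estimate holds for all
   indices up to [n]. *)
have [m mtd] : exists m : nat, t / m.+1%:R < d.
  exists (Num.truncn (t / d)); rewrite ltr_pdivrMr// mulrC -ltr_pdivrMr//.
  exact: truncnS_gt.
pose h := t / m.+1%:R.
have h0 : 0 < h by rewrite divr_gt0.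
have {}pq j : (j <= n)%N -> `|p h j - q h j| <= e * h.
  rewrite -ltnS => jn; apply: (pq h _ h0 (Ordinal jn)) => /=.
  by rewrite sub0r normrN gtr0_norm.
suff step l : (l <= m)%N -> forall j, (j <= n)%N ->
    `|p (l.+1%:R * h) j - q (l.+1%:R * h) j| <= l.+1%:R * (e * K * h).
  have /(_ i lin) := step m (leqnn m).
  by rewrite [m.+1%:R * h]mulrC divfK// mulrCA [m.+1%:R * h]mulrC divfK.
have eKh : e * h <= e * K * h by rewrite -mulrA ler_pM2l// ler_peMl// ltW.
elim: l => [_ j jn|l IH lm j jn].
  by rewrite !mul1r (le_trans (pq j jn)).
have {}IH := IH (ltnW lm).
have lh0 : 0 < l.+1%:R * h by rewrite mulr_gt0.
have lht : 0 < l.+1%:R * h <= t.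
  by rewrite lh0/= mulrC mulrAC ler_pdivrMr// ler_pM2l// ler_nat ltnW.
have -> : l.+2%:R * h = l.+1%:R * h + h by rewrite -natr1 mulrDl mul1r.
rewrite pD// qD// -sumrB.
(* The error splits into the old error transported by [p h] and the new one-step error weighted by
   [q]. *)
rewrite (eq_bigr (fun r : 'I_j.+1 => p h r *
  (p (l.+1%:R * h) (j - r)%N - q (l.+1%:R * h) (j - r)%N) +
  (p h r - q h r) * q (l.+1%:R * h) (j - r)%N)); last by move=> r _; ring.
rewrite big_split/= (le_trans (ler_normD _ _))//.
have H1 : `|\sum_(r < j.+1) p h r *
    (p (l.+1%:R * h) (j - r)%N - q (l.+1%:R * h) (j - r)%N)| <=
    l.+1%:R * (e * K * h).
  rewrite (le_trans (ler_norm_sum _ _ _))//.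
  have lK : 0 <= l.+1%:R * (e * K * h) by rewrite !mulr_ge0// ltW.
  rewrite -[leRHS]mul1r; apply: le_trans (ler_wpM2r lK (p1 h j h0 jn)).
  rewrite mulr_suml ler_sum// => r _; rewrite normrM ler_wpM2l// IH//.
  by rewrite (leq_trans _ jn)// leq_subr.
have H2 : `|\sum_(r < j.+1) (p h r - q h r) * q (l.+1%:R * h) (j - r)%N| <=
    n.+1%:R * (e * h * C).
  rewrite (le_trans (ler_norm_sum _ _ _))//.
  apply: (@le_trans _ _ (\sum_(r < j.+1) e * h * C)); last first.
    rewrite sumr_const card_ord -[leLHS]mulr_natl ler_wpM2r ?ler_nat//.
    by rewrite !mulr_ge0// ltW.
  apply: ler_sum => r _; rewrite normrM ler_pM//.
    by rewrite pq// (leq_trans _ jn)// -ltnS.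
  by rewrite qC// (leq_trans _ jn)// leq_subr.
apply: le_trans (lerD H1 H2) _.
have -> : l.+2%:R * (e * K * h) = l.+1%:R * (e * K * h) + e * h * K.
  by rewrite -natr1; ring.
by rewrite lerD2l mulrCA ler_pM2l ?mulr_gt0// lerDr.
Qed.

(** * The candidate law *)

(** All weights [i.+1] are at least 1, so every coordinate of a tuple in [Omega k m] is at most [m].
    The bound [N] is left free so that one finite index type, fixed by the truncation degree, serves
    all [m <= N]. *)
Lemma fsbig_Omega {V : zmodType} (k m N : nat) (F : {ffun 'I_k -> nat} -> V) :
  (m <= N)%N ->
  \sum_(y \in Omega k m) F y =
  \sum_(f : {ffun 'I_k -> 'I_N.+1} | (\sum_(i < k) i.+1 * f i)%N == m)
    F [ffun i => nat_of_ord (f i)].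
Proof.
move=> mN.
pose g (f : {ffun 'I_k -> 'I_N.+1}) : {ffun 'I_k -> nat} :=
  [ffun i => nat_of_ord (f i)].
have g_inj : injective g.
  move=> f f' /ffunP ff'; apply/ffunP => i; apply/val_inj.
  by have := ff' i; rewrite !ffunE.
pose s := [seq g f | f : {ffun 'I_k -> 'I_N.+1} <- enum {: {ffun 'I_k -> 'I_N.+1}}
                   & (\sum_(i < k) i.+1 * f i)%N == m].
have -> : Omega k m = [set` s].
  apply/seteqP; split => x /=.
    move=> xm; apply/mapP; exists [ffun i => inord (x i)].
      rewrite mem_filter mem_enum inE andbT; apply/eqP; rewrite -xm.
      apply: eq_bigr => i _; rewrite ffunE inordK// ltnS (leq_trans _ mN)//.
      by rewrite -xm (bigD1 i)//= mulSn -addnA leq_addr.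
    apply/ffunP => i; rewrite !ffunE inordK// ltnS (leq_trans _ mN)//.
    by rewrite -xm (bigD1 i)//= mulSn -addnA leq_addr.
  move=> /mapP[f]; rewrite mem_filter => /andP[/eqP fm _] ->.
  by rewrite /Omega/= -[RHS]fm; apply: eq_bigr => i _; rewrite ffunE.
rewrite -fsbig_seq/=; last by rewrite map_inj_uniq// filter_uniq// enum_uniq.
by rewrite big_map big_filter big_enum_cond.
Qed.

(** The compound Poisson candidate: the coefficient of [u^m] in the generating function
    [exp(- s * sum_j lam_j (1 - u^j))]. *)
Definition gcp_pmf {R : realType} (k : nat) (lam : 'I_k -> R) (s : R) (m : nat)
    : R :=
  expR (- (total_rate lam * s)) *
  \sum_(y \in Omega k m) \prod_(j < k) ((lam j * s) ^+ y j / (y j)`!%:R).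

(** * Truncated generating functions of the candidate law: semigroup property and derivative at time
    0 *)

Section generating_polynomial.
Context {R : realType}.
Implicit Types (l s h : R) (n m i : nat).

(** The Poisson generating function cut at degree [n], so that polynomials replace power series;
    after multiplication only the coefficients up to [n] are meaningful. *)
Definition poisson_poly n l s : {poly R} :=
  \poly_(m < n.+1) (expR (- (l * s)) * ((l * s) ^+ m / m`!%:R)).

(* The jumps of size j form a Poisson process of rate lam_j, and the GCP is the
   sum over j of j times these independent processes. *)
Definition gcp_poly n (k : nat) (lam : 'I_k -> R) s : {poly R} :=
  \prod_(j < k) (poisson_poly n (lam j) s \Po 'X^(j.+1)).

(** Distributing the product over the sums, a choice [f] of jump counts contributes to degree
    [sum_j j.+1 * f j]; degree [m] thus collects exactly [Omega k m], and truncation at [n >= m]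
    loses no term. *)
Lemma coef_gcp_poly n k (lam : 'I_k -> R) s m : (m <= n)%N ->
  (gcp_poly n lam s)`_m = gcp_pmf lam s m.
Proof.
move=> mn; rewrite /gcp_poly /gcp_pmf (fsbig_Omega _ mn).
under eq_bigr => j _.
  rewrite /poisson_poly poly_def rmorph_sum/=.
  under eq_bigr => i _ do rewrite linearZ/= comp_Xn_poly -exprM.
  over.
rewrite bigA_distr_bigA/= coef_sum mulr_sumr big_mkcond/=.
rewrite [RHS]big_mkcond/=; apply: eq_bigr => f _.
under eq_bigr => j _ do rewrite -mul_polyC.
rewrite big_split/= prodrXr -rmorph_prod/= coefCM coefXn eq_sym.
case: ifP => _; last by rewrite mulr0.
rewrite mulr1 big_split/=; congr (_ * _).
  by rewrite -expR_sum sumrN mulr_suml.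
by apply: eq_bigr => j _; rewrite ffunE.
Qed.

(** The binomial expansion of [(l * s + l * h) ^+ m]. *)
Lemma poisson_polyM n l s h m : (m <= n)%N ->
  (poisson_poly n l s * poisson_poly n l h)`_m = (poisson_poly n l (s + h))`_m.
Proof.
move=> mn; rewrite coefM coef_poly ltnS mn.
rewrite mulrDr exprDn opprD expRD mulr_suml mulr_sumr.
rewrite [RHS](reindex_inj rev_ord_inj)/=; apply: eq_bigr => i _.
have im : (i <= m)%N by rewrite -ltnS.
rewrite !coef_poly !ltnS (leq_trans im mn) (leq_trans (leq_subr _ _) mn).
rewrite subSS subKn// bin_sub// -[in RHS]mulr_natr.
have f0 a : a`!%:R != 0 :> R by rewrite pnatr_eq0 -lt0n fact_gt0.
have -> : 'C(m, i)%:R = m`!%:R / (i`!%:R * (m - i)`!%:R) :> R.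
  by rewrite -(bin_fact im) !natrM mulfK// mulf_neq0.
by field; rewrite !f0.
Qed.

(** Agreement up to degree [n] is congruence modulo ['X^n.+1], which products respect. *)
Lemma coef_prod_eq n (I : Type) (r : seq I) (F G : I -> {poly R}) :
  (forall j m, (m <= n)%N -> (F j)`_m = (G j)`_m) ->
  forall m, (m <= n)%N -> (\prod_(j <- r) F j)`_m = (\prod_(j <- r) G j)`_m.
Proof.
move=> FG; elim/big_ind2 : _ => // [p p' q q' pp' qq' m mn|j _]; last exact: FG.
rewrite !coefM; apply: eq_bigr => i _.
by rewrite pp' ?qq'// ?(leq_trans _ mn)// ?leq_subr// -ltnS.
Qed.

Lemma gcp_polyM n k (lam : 'I_k -> R) s h m : (m <= n)%N ->
  (gcp_poly n lam s * gcp_poly n lam h)`_m = (gcp_poly n lam (s + h))`_m.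
Proof.
rewrite -big_split/=; apply: coef_prod_eq => j {}m mn.
rewrite -rmorphM/= !coef_comp_poly_Xn//; case: ifP => // _.
by rewrite poisson_polyM// (leq_trans (leq_div _ _) mn).
Qed.

Lemma gcp_pmfD k (lam : 'I_k -> R) s h m :
  gcp_pmf lam (s + h) m = \sum_(j < m.+1) gcp_pmf lam h j * gcp_pmf lam s (m - j).
Proof.
rewrite -(@coef_gcp_poly m)// -gcp_polyM// mulrC coefM.
by apply: eq_bigr => j _; rewrite !coef_gcp_poly// ?leq_subr// -ltnS.
Qed.

Let scaleE (a b : R) : a *: b = a * b. Proof. by []. Qed.

(** Leibniz rule at a point where all factors are 1 modulo ['X^n.+1]: the derivatives simply add. *)
Lemma is_derive_coef_prod n (I : Type) (r : seq I) (F : I -> R -> {poly R})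
    (D : I -> nat -> R) :
  (forall j m, (m <= n)%N -> (F j 0)`_m = (1 : {poly R})`_m) ->
  (forall j m, (m <= n)%N -> is_derive (0 : R) 1 (fun s => (F j s)`_m) (D j m)) ->
  forall m, (m <= n)%N ->
    is_derive (0 : R) 1 (fun s => (\prod_(j <- r) F j s)`_m) (\sum_(j <- r) D j m).
Proof.
move=> F0 FD; elim: r => [|j r IH] m mn.
  rewrite big_nil; under eq_fun do rewrite big_nil.
  exact: is_derive_cst.
have P0 i : (i <= n)%N -> (\prod_(j <- r) F j 0)`_i = (1 : {poly R})`_i.
  move=> iin; rewrite (@coef_prod_eq n _ _ _ (fun=> 1))// ?big1_eq//.
have -> : (fun s => (\prod_(j <- j :: r) F j s)`_m) =
    \sum_(i < m.+1) ((fun s => (F j s)`_i) *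
                     (fun s => (\prod_(j <- r) F j s)`_(m - i))).
  by apply/funext => s; rewrite big_cons coefM fct_sumE.
have im (i : 'I_m.+1) : (i <= n)%N by rewrite (leq_trans _ mn)// -ltnS.
have mi i : (m - i <= n)%N by rewrite (leq_trans _ mn)// leq_subr.
apply: is_derive_eq.
  apply: is_derive_sum => i; apply: is_deriveM; [exact: FD|exact: IH].
(* The values at 0 are coefficients of the polynomial 1, so the first family of terms survives only
   at [i = 0] and the second only at [i = m]. *)
rewrite big_cons (eq_bigr (fun i : 'I_m.+1 =>
    (i == 0%N :> nat)%:R *: \sum_(j <- r) D j (m - i)%N +
    (m - i == 0)%N%:R *: D j i)); last first.
  by move=> i _ /=; rewrite F0// P0// !coef1.
rewrite big_split/= addrC; congr (_ + _).
  rewrite (bigD1 ord_max)//= subnn eqxx scale1r big1 ?addr0// => i.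
  rewrite -val_eqE/= => ine; rewrite subn_eq0 leqNgt.
  by rewrite ltn_neqAle ine -ltnS ltn_ord scale0r.
rewrite (bigD1 ord0)//= scale1r subn0 [X in _ + X]big1 ?addr0// => i.
by rewrite -val_eqE/= => /negPf ->; rewrite scale0r.
Qed.

Lemma coef_poisson_poly0 n l m : (m <= n)%N ->
  (poisson_poly n l 0)`_m = (m == 0%N)%:R.
Proof.
move=> mn; rewrite coef_poly ltnS mn mulr0 oppr0 expR0 mul1r.
by case: m mn => [|m] _; rewrite ?expr0 ?divr1// expr0n mul0r.
Qed.

Lemma is_derive_poisson n l m : (m <= n)%N ->
  is_derive (0 : R) 1 (fun s => (poisson_poly n l s)`_m)
    (l * ((m == 1%N)%:R - (m == 0%N)%:R)).
Proof.
move=> mn.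
have -> : (fun s => (poisson_poly n l s)`_m) =
    (expR \o (fun s => - l * s)) * ((m`!%:R^-1 * l ^+ m) *: (id ^+ m)).
  apply/funext => s; rewrite coef_poly ltnS mn /= exprMn fctE/=.
  by rewrite mulNr !fctE scaleE; ring.
have dl : is_derive (0 : R) 1 (fun s : R => - l * s) (- l).
  rewrite (_ : (fun s => _) = (- l) *: id)//.
  by apply: is_derive_eq; exact: mulr1.
have de : is_derive (0 : R) 1 (expR \o (fun s : R => - l * s)) (- l).
  have d1 := is_derive_expR (- l * 0).
  apply: is_derive_eq (is_derive1_comp d1 dl) _.
  by rewrite mulr0 expR0 ?scale1r ?mul1r.
apply: is_derive_eq; rewrite !scaleE !fctE mulr0 expR0 -[_ *: 0 ^+ m]/(_ * 0 ^+ m).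
case: m mn => [|[|m]] _ /=; rewrite ?expr0 ?expr1 ?expr0n/= ?factE/= ?invr1; ring.
Qed.

(** At time 0 each factor of the generating polynomial is 1 up to degree [m], so the derivative of
    the product is the sum of the Poisson derivatives, moved to degree [j.+1] by the substitution of
    ['X^(j.+1)]. *)
Lemma gcp_pmf_first_order k (lam : 'I_k -> R) m e : 0 < e ->
  \forall h \near 0^'+, `|gcp_pmf lam h m - ((m == 0%N)%:R +
    (\sum_(j < k) lam j * ((m == j.+1)%:R - (m == 0%N)%:R)) * h)| <= e * h.
Proof.
move=> e0.
have F0 (j : 'I_k) i : (i <= m)%N ->
    (poisson_poly m (lam j) 0 \Po 'X^(j.+1))`_i = (1 : {poly R})`_i.
  move=> im; rewrite coef_comp_poly_Xn// coef1; case: ifPn => [ji|].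
    rewrite coef_poisson_poly0 ?(leq_trans (leq_div _ _))//.
    by rewrite -[in RHS](divnK ji) muln_eq0 orbF.
  by case: i im => //; rewrite dvdn0.
have FD (j : 'I_k) i : (i <= m)%N -> is_derive (0 : R) 1
    (fun s => (poisson_poly m (lam j) s \Po 'X^(j.+1))`_i)
    (lam j * ((i == j.+1)%:R - (i == 0%N)%:R)).
  move=> im; have [ji|nji] := boolP (j.+1 %| i)%N.
    under eq_fun do rewrite coef_comp_poly_Xn// ji.
    (* With [i] written as quotient times [j.+1], the two tests on [i] ask whether the quotient is 1
       or 0. *)
    rewrite -[in i == j.+1](divnK ji) -[in i == 0%N](divnK ji).
    rewrite -[X in _ == X]mul1n eqn_pmul2r// muln_eq0 orbF.
    by apply: is_derive_poisson; rewrite (leq_trans (leq_div _ _)).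
  have -> : (i == j.+1) = false by apply/negP => /eqP ij; rewrite ij dvdnn in nji.
  have -> : (i == 0%N) = false by apply/negP => /eqP ij; rewrite ij dvdn0 in nji.
  under eq_fun do rewrite coef_comp_poly_Xn// (negPf nji).
  by rewrite subrr mulr0; exact: is_derive_cst.
have := @is_derive_coef_prod m _ (index_enum 'I_k) _ _ F0 FD m (leqnn m).
set A := \sum_(j < k) _ => -[dg gA].
set g := (fun s => _) in dg gA.
have gE h : g h = gcp_pmf lam h m by rewrite -(@coef_gcp_poly m).
have g0 : g 0 = (m == 0%N)%:R.
  by rewrite /g (@coef_prod_eq m _ _ _ (fun=> 1))// big1_eq coef1.
have {dg}gA' : (fun h => h^-1 *: (g (h *: 1 + 0) - g 0)) @ 0^' --> A.
  rewrite -gA; exact: dg.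
move/cvgrPdist_le : gA' => /(_ _ e0) [d /= d0 gd].
exists d => //= h /= hd h0.
have := gd h hd (lt0r_neq0 h0).
rewrite (_ : h *: 1 + 0 = h) ?scaleE; last by rewrite addr0; exact: mulr1.
rewrite -gE -g0 => H.
rewrite distrC -ler_pdivrMr// -(gtr0_norm h0) -normfV -normrM (gtr0_norm h0).
by rewrite (_ : _ / h = A - h^-1 * (g h - g 0))//; field; rewrite gt_eqF.
Qed.

End generating_polynomial.

(** * The law of the generalized counting process *)

(** Each set lies in the union of the other with the null set [N]. *)
Lemma ae_measure_eq {d} {T : measurableType d} {R : realType}
    (mu : {measure set T -> \bar R}) (A B : set T) :
  measurable A -> measurable B -> {ae mu, forall w, A w <-> B w} -> mu A = mu B.
Proof.
move=> mA mB [N [mN N0 AB]].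
suff le C D : measurable C -> measurable D -> (forall w, ~ N w -> C w -> D w) ->
    (mu C <= mu D)%E.
  apply/eqP; rewrite eq_le; apply/andP; split; apply: le => // w Nw.
    by have [] := contrapT (fun h => Nw (AB w h)).
  by have [] := contrapT (fun h => Nw (AB w h)).
move=> mC mD CD; apply: (@le_trans _ _ (mu (D `|` N))).
  rewrite le_measure ?inE//; first exact: measurableU.
  by move=> w Cw; have [Nw|Nw] := pselect (N w); [right|left; exact: CD].
by rewrite -[leRHS]adde0 -N0; exact: measureU2.
Qed.

Section gcp.
Context {R : realType} {d : measure_display} {T : measurableType d}.
Context {P : probability T R} {k : nat} {lam : 'I_k -> R}.
Context {M : R -> {RV P >-> nat}}.
Hypothesis M_GCP : GCP lam M.

Let X (s : R) (w : T) : R := (M s w)%:R.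

Lemma measurable_gcp_preimage (s : R) (A : set nat) : measurable (M s @^-1` A).
Proof. exact: measurable_funPTI. Qed.
Hint Resolve measurable_gcp_preimage : core.

Lemma measurable_gcp s : measurable_fun setT (X s).
Proof. by apply: measurableT_comp => //. Qed.

Lemma measurable_gcp_increment s s' (B : set R) : measurable B ->
  measurable ((fun w => X s w - X s' w) @^-1` B).
Proof.
move=> mB; rewrite -[_ @^-1` _]setTI.
by apply: (measurable_funB (measurable_gcp s) (measurable_gcp s')).
Qed.

Lemma gcp_start : {ae P, forall w, M 0 w = 0%N}.
Proof.
have /= := Levy_start (GCP_Levy M_GCP).
by apply: filterS => w /eqP; rewrite pnatr_eq0 => /eqP.
Qed.

Lemma gcp_increment (s h : R) (B : set R) : 0 <= s -> 0 <= h -> measurable B ->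
  P ((fun w => X (s + h) w - X s w) @^-1` B) = P (X h @^-1` B).
Proof.
move=> s0 h0 mB.
rewrite (Levy_stationary_increments (GCP_Levy M_GCP))//.
apply: ae_measure_eq; first exact: measurable_gcp_increment.
  by rewrite -[_ @^-1` _]setTI; exact: measurable_gcp.
by apply: filterS gcp_start => w /= M0; rewrite /X M0 subr0.
Qed.

(** By stationarity the increment has the law of [M (t - s)], which takes natural values and hence
    is never negative. The null set depends on [s] and [t]. *)
Lemma gcp_nondecreasing (s t : R) : 0 <= s -> s <= t ->
  {ae P, forall w, (M s w <= M t w)%N}.
Proof.
move=> s0 st; exists ((fun w => X t w - X s w) @^-1` `]-oo, 0[); split.
- exact: measurable_gcp_increment.
- rewrite -[t](subrK s) addrC gcp_increment ?subr_ge0//.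
  by rewrite (_ : _ @^-1` _ = set0) ?measure0// -subset0 => w;
    rewrite /= in_itv/= ltNge ler0n.
- by move=> w /= /negP; rewrite -ltnNge in_itv/= subr_lt0 ltr_nat.
Qed.

(** Independence of the two increments over the grid 0, [s], [s + h], followed by stationarity. *)
Lemma gcp_joint (s h : R) (r m : nat) : 0 < s -> 0 < h ->
  P (M s @^-1` [set r] `&` M (s + h) @^-1` [set (r + m)%N]) =
  (P (M s @^-1` [set r]) * P (M h @^-1` [set m]))%E.
Proof.
move=> s0 h0.
pose u (i : nat) : R := if i is 0 then 0 else if i is 1 then s else s + h.
have u_lt i : (i < 2)%N -> u i < u i.+1.
  by case: i => [|[|]]//= _; rewrite ltrDl.
pose B (i : 'I_2) : set R := if i == ord0 then [set r%:R] else [set m%:R].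
have mB i : measurable (B i) by rewrite /B; case: ifP.
have := Levy_independent_increments (GCP_Levy M_GCP) (lexx 0 : 0 <= u 0%N) u_lt mB.
rewrite big_ord_recr big_ord1/= => H.
have XE s' j : X s' @^-1` [set j%:R] = M s' @^-1` [set j].
  by apply/seteqP; split=> w /=; rewrite /X => /eqP; rewrite ?eqr_nat => /eqP// ->.
rewrite -(XE s) -(XE h) -(gcp_increment (ltW s0) (ltW h0))//.
have E := @gcp_increment 0 s [set r%:R] (lexx 0) (ltW s0) (measurable_set1 _).
rewrite add0r in E.
rewrite -E XE.
(* Since [M 0 = 0] almost surely, fixing both increments amounts to fixing [M s] and [M (s + h)]. *)
transitivity (P (\bigcap_(i in [set: 'I_2]) ((fun w => X (u i.+1) w - X (u i) w) @^-1` B i))).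
  apply: ae_measure_eq.
  - exact: measurableI.
  - by apply: fin_bigcap_measurable => // i _; exact: measurable_gcp_increment.
  - apply: filterS gcp_start => w M0; split=> [[/= Ms Mt] i _|H'].
      case: i => -[|[|]]//= i; rewrite /X /= ?M0 ?Ms ?Mt ?subr0//.
      by rewrite natrD addrC addKr.
    have /= := H' ord0 Logic.I; rewrite /X M0 subr0 => /eqP; rewrite eqr_nat => /eqP Ms.
    have /= := H' (lift ord0 ord0) Logic.I; rewrite /X Ms => /eqP.
    rewrite subr_eq -natrD eqr_nat addnC => /eqP Mt; by split.
by rewrite H/=; congr (_ * P _)%E.
Qed.

Let p (s : R) (m : nat) : R := fine (P (M s @^-1` [set m])).

Let EFin_p s m : (p s m)%:E = P (M s @^-1` [set m]).
Proof. by rewrite fineK// fin_num_measure. Qed.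

Lemma gcp_levels_trivIset s (B : set T) :
  trivIset setT (fun r => M s @^-1` [set r] `&` B).
Proof.
apply/trivIsetP => i j _ _ /eqP ij; apply/seteqP; split => // w.
by move=> [[/= Mi _] [/= Mj _]]; apply: ij; rewrite -Mi -Mj.
Qed.

Lemma gcp_split s (B : set T) n : measurable B ->
  {ae P, forall w, B w -> (M s w <= n)%N} ->
  P B = (\sum_(r < n.+1) P (M s @^-1` [set nat_of_ord r] `&` B))%E.
Proof.
move=> mB Bn.
have mF i : measurable (M s @^-1` [set i] `&` B) by exact: measurableI.
rewrite -(measure_bigsetU _ mF (@gcp_levels_trivIset s B)).
apply: ae_measure_eq => //; first exact: bigsetU_measurable.
apply: filterS Bn => w Bn; rewrite -(bigcup_mkord _ (fun r => M s @^-1` [set r] `&` B)).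
split=> [Bw|[r _ []//]].
by exists (M s w) => //=; rewrite ltnS Bn.
Qed.

(** The mass bound that makes convolution with [p s] non-expansive in the telescoping argument. *)
Lemma gcp_prob_sum_le1 s n : \sum_(r < n.+1) `|p s r| <= 1.
Proof.
under eq_bigr do rewrite ger0_norm ?fine_ge0//.
rewrite -lee_fin -sumEFin; under eq_bigr do rewrite EFin_p.
have := @gcp_levels_trivIset s setT; under eq_fun do rewrite setIT; move=> tF.
rewrite -(measure_bigsetU P (fun r => measurable_gcp_preimage s [set r]) tF).
by apply: probability_le1; exact: bigsetU_measurable.
Qed.

Lemma gcp_transition s t (r n : nat) : 0 < s < t -> (r <= n)%N ->
  P (M s @^-1` [set r] `&` M t @^-1` [set n]) = (p s r * p (t - s) (n - r))%:E.
Proof.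
move=> /andP[s0 st] rn; rewrite EFinM !EFin_p -gcp_joint ?subr_gt0//.
by rewrite subnKC// addrC subrK.
Qed.

Lemma gcp_convolution s h i : 0 < s -> 0 < h ->
  p (s + h) i = \sum_(j < i.+1) p h j * p s (i - j).
Proof.
move=> s0 h0; apply: EFin_inj; rewrite EFin_p -sumEFin.
rewrite (@gcp_split s _ i)//; last first.
  have := @gcp_nondecreasing s (s + h) (ltW s0).
  rewrite lerDl => /(_ (ltW h0)); apply: filterS => w sh /= Mi.
  by rewrite -[leqRHS]Mi.
(* After reversal [j] is the increment over the last [h] and [i - j] the value at time [s]. *)
rewrite [LHS](reindex_inj rev_ord_inj)/=; apply: eq_bigr => j _.
rewrite subSS gcp_transition ?leq_subr ?s0 ?ltrDl//.
have ji : (j <= i)%N by rewrite -ltnS.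
by rewrite (subKn ji) [s + h]addrC addrK mulrC.
Qed.

Lemma gcp_prob0 m : p 0 m = (m == 0%N)%:R.
Proof.
apply: EFin_inj; rewrite EFin_p; have [->|m0] := eqVneq m 0%N.
  rewrite -(probability_setT P); apply: ae_measure_eq => //.
  by apply: filterS gcp_start => w M0; split.
transitivity (P set0); last by rewrite measure0.
apply: ae_measure_eq => //.
apply: filterS gcp_start => w M0; split=> //= /esym/eqP.
by rewrite M0 (negPf m0).
Qed.

(** The event [M 0 = 0] is almost sure, so the rates stated conditionally at time 0 are rates of the
    law itself. *)
Lemma gcp_cond_prob0 h m :
  cond_prob P (M (0 + h) @^-1` [set m]) (M 0 @^-1` [set 0%N]) = p h m.
Proof.
rewrite /cond_prob -/(p 0 0) gcp_prob0 divr1 add0r; congr fine.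
apply: ae_measure_eq => //; first exact: measurableI.
by apply: filterS gcp_start => w M0; split=> [[]|].
Qed.

(** The three rate conditions, taken at time 0 from state 0, put into the single formula already
    proved for [gcp_pmf]: no jump for [m = 0], a jump for [1 <= m <= k], a large jump for
    [m > k]. *)
Lemma gcp_first_order m e : 0 < e ->
  \forall h \near 0^'+, `|p h m - ((m == 0%N)%:R +
    (\sum_(j < k) lam j * ((m == j.+1)%:R - (m == 0%N)%:R)) * h)| <= e * h.
Proof.
move=> e0.
have P0 : P (M 0 @^-1` [set 0%N]) != 0%E by rewrite -EFin_p gcp_prob0 eqe oner_eq0.
have o_near (f : R -> R) : f =o_ (0^'+) (fun h : R => h) ->
    \forall h \near 0^'+, `|f h| <= e * h.
  move/eqoP => /(_ _ e0); apply: filterS2 (nbhs_right_gt 0) => h h0.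
  by rewrite (gtr0_norm h0).
case: m => [|m].
  apply: filterS (o_near _ (GCP_stay M_GCP (lexx 0) P0)) => h.
  rewrite gcp_cond_prob0; congr (`|_ - _| <= _); rewrite /total_rate.
  by under [in RHS]eq_bigr do rewrite sub0r mulrN1; rewrite sumrN mulNr.
have [mk|km] := ltnP m k.
  have := GCP_jump M_GCP (Ordinal mk) (lexx 0) P0.
  move/o_near; apply: filterS => h; rewrite gcp_cond_prob0/= add0r.
  rewrite (bigD1 (Ordinal mk))//= eqxx subr0 mulr1 big1 ?addr0// => j.
  rewrite -val_eqE/= eqSS eq_sym => /negPf ->; by rewrite subrr mulr0.
have := GCP_large_jump M_GCP (lexx 0) P0 (_ : k < m.+1)%N.
move=> /(_ km)/o_near; apply: filterS => h; rewrite gcp_cond_prob0/= add0r.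
rewrite big1 ?mul0r ?subr0// => j _; rewrite eqSS gtn_eqF ?subrr ?mulr0//.
exact: leq_trans km.
Qed.

Hypothesis lam_ge0 : forall i, 0 <= lam i.

Lemma total_rate_ge0 : 0 <= total_rate lam.
Proof. by rewrite sumr_ge0. Qed.

Lemma gcp_probE t n : 0 < t -> p t n = gcp_pmf lam t n.
Proof.
move=> t0.
(* For [h <= t] the exponential is at most 1 and the powers of [lam j * h] are at most those at [t],
   so [w r] bounds [gcp_pmf lam h r]; summing over [r] gives one constant for all indices. *)
pose w r : R := \sum_(y \in Omega k r) \prod_(j < k) ((lam j * t) ^+ y j / (y j)`!%:R).
have w_ge0 r : 0 <= w r.
  rewrite /w fsumr_ge0// => y _; rewrite prodr_ge0// => j _.
  by rewrite divr_ge0// exprn_ge0// mulr_ge0// ltW.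
apply: (@convolution_semigroup_eq R n p (gcp_pmf lam) (\sum_(r < n.+1) w r)) => //.
- by move=> *; exact: gcp_convolution.
- by move=> *; exact: gcp_pmfD.
- by move=> *; exact: gcp_prob_sum_le1.
- move=> h i /andP[h0 ht] iin.
  have W0 : 0 <= \sum_(y \in Omega k i) \prod_(j < k) ((lam j * h) ^+ y j / (y j)`!%:R).
    rewrite fsumr_ge0// => y _; rewrite prodr_ge0// => j _.
    by rewrite divr_ge0// exprn_ge0// mulr_ge0// ltW.
  rewrite /gcp_pmf ger0_norm ?mulr_ge0 ?expR_ge0//.
  apply: (@le_trans _ _ (w i)); last first.
    rewrite (bigD1 (Ordinal (iin : (i < n.+1)%N)))//= lerDl sumr_ge0//.
  rewrite -[leRHS]mul1r ler_pM ?expR_ge0//.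
    by rewrite expR_le1 oppr_le0 mulr_ge0 ?total_rate_ge0// ltW.
  rewrite /w !(fsbig_Omega _ (leqnn i)); apply: ler_sum => y _.
  apply: ler_prod => j _; have lh0 : 0 <= lam j * h by rewrite mulr_ge0// ltW.
  rewrite divr_ge0 ?exprn_ge0//= ler_pM2r ?invr_gt0 ?ltr0n ?fact_gt0//.
  by rewrite lerXn2r ?nnegrE// ?ler_wpM2l// mulr_ge0// ltW.
(* Both laws share the first-order expansion [A], and each may deviate from it by [e / 2 * h]. *)
- move=> i iin e e0; have e20 : 0 < e / 2 by rewrite divr_gt0.
  apply: filterS2 (gcp_first_order i e20) (gcp_pmf_first_order lam i e20) => h.
  set A := (X in `|p h i - X|) => pA qA.
  rewrite (le_trans (ler_distD A _ _))// [e]splitr mulrDl lerD//.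
  by rewrite distrC.
Qed.

Lemma expectation_gcp_bridge s t n : 0 < s < t ->
  (\int[P]_(w in M t @^-1` [set n]) (X s w)%:E =
   (\sum_(r < n.+1) r%:R * (gcp_pmf lam s r * gcp_pmf lam (t - s) (n - r)))%:E)%E.
Proof.
move=> /[dup] sst /andP[s0 st].
(* On the event [M t = n], monotonicity gives [M s <= n] almost surely, so there [M s] coincides
   with this finite sum. *)
pose g w : R := \sum_(r < n.+1) r%:R * \1_(M s @^-1` [set nat_of_ord r]) w.
have mg : measurable_fun setT g.
  by apply: measurable_sum => r; exact: measurable_funM.
rewrite (@ae_eq_integral _ _ _ _ _ (EFin \o g))//; last 3 first.
- by apply/measurable_EFinP; apply: measurable_funTS; exact: measurable_gcp.
- by apply/measurable_EFinP; exact: measurable_funTS.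
- apply: filterS (gcp_nondecreasing (ltW s0) (ltW st)) => w Mst /= Mn.
  rewrite {}Mn -ltnS in Mst; congr EFin; rewrite /g (bigD1 (Ordinal Mst))//=.
  rewrite indicE mem_set// mulr1 big1 ?addr0// => r rM.
  rewrite indicE memNset ?mulr0//= => /esym rE.
  by move/eqP : rM; apply; apply/val_inj.
rewrite /comp/g; under eq_integral do rewrite -sumEFin.
rewrite ge0_integral_sum//; last first.
  move=> r; apply/measurable_EFinP; apply: measurable_funTS.
  exact: measurable_funM.
rewrite -sumEFin; apply: eq_bigr => r _.
under eq_integral do rewrite EFinM.
rewrite ge0_integralZl//; last first.
  by apply/measurable_EFinP; exact: measurable_funTS.
rewrite integral_indic// EFinM; congr (_ * _)%E.
rewrite -!gcp_probE ?subr_gt0//; apply: gcp_transition => //.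
by rewrite -ltnS.
Qed.

End gcp.

(** * Beta integrals *)

Section beta_integral.
Context {R : realType}.
Notation mu := (@lebesgue_measure R).
Local Open Scope ereal_scope.

(** [c] times the image of Lebesgue measure under [x |-> c * x] agrees with Lebesgue measure on the
    intervals []a, b]], hence everywhere. *)
Lemma ge0_integral_dilation (c : R) (D : set R) (f : R -> \bar R) :
  (0 < c)%R -> measurable D -> measurable_fun D f ->
  (forall y, D y -> 0 <= f y) ->
  \int[mu]_(y in D) f y =
  c%:E * \int[mu]_(x in (fun x : R => c * x)%R @^-1` D) f (c * x)%R.
Proof.
move=> c0 mD mf f0.
pose phi : measurableTypeR R -> measurableTypeR R := fun x : R => (c * x)%R.
have mphi : measurable_fun setT phi by exact: mulrl_measurable.
have <- : \int[pushforward mu phi]_(y in D) f y =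
    \int[mu]_(x in phi @^-1` D) f (c * x)%R.
  by rewrite ge0_integral_pushforward// => y; rewrite inE => /f0.
have cnng : (0 <= c)%R by exact: ltW.
rewrite -[c]/((NngNum cnng)%:num) -ge0_integral_mscale//.
apply: eq_measure_integral => A mA _.
apply: lebesgue_measure_unique => // _ [[a b]] _ <-.
change (mu `]a, b] = c%:E * mu (phi @^-1` `]a, b])).
have -> : phi @^-1` `]a, b] = `](a / c)%R, (b / c)%R]%classic.
  apply/seteqP; split => x /=;
    by rewrite !in_itv/= /phi ltr_pdivrMr// ler_pdivlMr// mulrC.
rewrite !lebesgue_measure_itv/= !lte_fin ltr_pM2r ?invr_gt0//.
case: ifPn => _; last by rewrite mule0.
by rewrite -!EFinB -EFinM -mulrBl mulrC divfK// gt_eqF.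
Qed.

Lemma measurable_subr_powR (t a : R) :
  measurable_fun setT (fun s : R => (t - s) `^ a)%R.
Proof.
have mt : measurable_fun setT (fun s : R => t - s)%R by exact: measurable_funB.
exact: (measurableT_comp (measurable_powR a) mt).
Qed.

(** For [b < 1] the integrand is unbounded near 1, so the fundamental theorem of calculus is applied
    on intervals that stop before 1, where the integral is at most [b^-1]; monotone convergence
    concludes. *)
Lemma integral_onem_powR_lty (b : R) : (0 < b)%R ->
  \int[mu]_(u in `[0%R, 1%R]) ((1 - u) `^ (b - 1))%:E < +oo.
Proof.
move=> b0.
pose f (u : R) := ((1 - u) `^ (b - 1))%R.
have mf : measurable_fun setT f.
  exact: measurable_subr_powR.
rewrite -integral_itv_bndo_bndc; last first.
  by apply/measurable_EFinP; exact: measurable_funTS.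
(* The shift [i.+2] keeps the right end strictly between 0 and 1, even for [i = 0]. *)
pose F (i : nat) := `[0%R, (1 - i.+2%:R^-1)%R]%classic : set R.
have F1 (i : nat) : (0 < (1 - i.+2%:R^-1 : R) < 1)%R.
  by rewrite subr_gt0 invf_lt1// ltr1n/= ltrBlDr ltrDl invr_gt0.
have FE : `[0%R, 1%R[%classic = \bigcup_i F i.
  apply/seteqP; split => u /=.
    rewrite in_itv/= => /andP[u0 u1].
    exists (Num.truncn (1 - u)^-1) => //=.
    rewrite /F/= in_itv/= u0/= lerBrDr -lerBrDl.
    rewrite invf_ple ?posrE ?subr_gt0// ltW// (lt_trans (truncnS_gt _))//.
    by rewrite ltr_nat.
  move=> [i _]; rewrite /F/= !in_itv/= => /andP[-> /le_lt_trans]; apply.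
  by have /andP[] := F1 i.
rewrite FE.
have bound i : \int[mu]_(u in F i) (f u)%:E <= (b^-1)%:E.
  have /andP[r0 r1] := F1 i; rewrite /F.
  move: r0 r1; set r := (1 - _)%R => r0 r1.
  pose G (u : R) := (- b^-1 * (1 - u) `^ b)%R.
  have dp (a u : R) : (u < 1)%R ->
      is_derive u 1%R (fun u => (1 - u) `^ a)%R (- (a * (1 - u) `^ (a - 1)))%R.
    move=> u1.
    have d1 : is_derive u 1%R (fun u : R => 1 - u)%R (- 1)%R.
      rewrite (_ : (fun u : R => _) = (cst 1 - id)%R)//.
      by apply: is_derive_eq; rewrite sub0r.
    have d2 : is_derive (1 - u)%R 1%R (fun x : R => x `^ a)%R (a * (1 - u) `^ (a - 1))%R.
      by apply: is_derive1_powR; rewrite subr_gt0.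
    rewrite (_ : (fun u => (1 - u) `^ a)%R =
      (fun x : R => x `^ a)%R \o (fun u : R => 1 - u)%R)//.
    have d3 := @is_derive1_comp _ (fun x => x `^ a)%R (fun u => 1 - u)%R u _ _ d2 d1.
    by apply: is_derive_eq d3 _; rewrite mulrN1.
  have dG (u : R) : (u < 1)%R -> is_derive u 1%R G (f u).
    move=> u1; have d1 := dp b u u1.
    rewrite (_ : G = (- b^-1 *: (fun u => (1 - u) `^ b))%R)//.
    apply: is_derive_eq; rewrite -[LHS]/(_ * _)%R mulrNN mulrA mulVf ?mul1r//.
    by rewrite gt_eqF.
  rewrite (@continuous_FTC2 _ f G 0%R r)//.
  - rewrite -EFinB lee_fin /G subr0 powR1 mulr1 opprK gerDr mulNr oppr_le0.
    by rewrite mulr_ge0 ?powR_ge0// invr_ge0 ltW.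
  - apply: derivable_within_continuous => u; rewrite in_itv/= => /andP[_ ur].
    by have [] := dp (b - 1)%R u (le_lt_trans ur r1).
  - split.
    + by move=> u; rewrite in_itv/= => /andP[_ ur]; have [] := dG u (lt_trans ur r1).
    + apply: cvg_at_right_filter; apply: differentiable_continuous.
      by apply/derivable1_diffP; have [] := dG 0%R ltr01.
    + apply: cvg_at_left_filter; apply: differentiable_continuous.
      by apply/derivable1_diffP; have [] := dG r r1.
  - move=> u; rewrite in_itv/= => /andP[_ ur]; rewrite derive1E.
    by have [_ ->] := dG u (lt_trans ur r1).
have Fcvg : \int[mu]_(u in F i) (f u)%:E @[i --> \oo] -->
    \int[mu]_(u in \bigcup_i F i) (f u)%:E.
  apply: ge0_nondecreasing_set_cvg_integral.
  - move=> i j ij; apply/subsetPset => u; rewrite /F/= !in_itv/= => /andP[->/=].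
    by move=> /le_trans; apply; rewrite lerB// lef_pV2 ?posrE// ler_nat !ltnS.
  - by move=> i; exact: measurable_itv.
  - by move=> i; apply/measurable_EFinP; exact: measurable_funTS.
  - by move=> i u _; rewrite lee_fin powR_ge0.
apply: (@le_lt_trans _ _ (b^-1)%:E); last by rewrite ltry.
by apply: cvge_le Fcvg; exact: nearW.
Qed.

(** Substitution [s = t * u]. *)
Lemma integral_beta_scaled (t a b : R) : (0 < t)%R -> (0 <= a)%R -> (0 < b)%R ->
  \int[mu]_(s in `[0%R, t]) (s `^ a * (t - s) `^ (b - 1))%:E =
  (t `^ (a + b) * Beta (a + 1) b)%:E.
Proof.
move=> t0 a0 b0.
pose f (s : R) := (s `^ a * (t - s) `^ (b - 1))%R.
have mf : measurable_fun setT f.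
  by apply: measurable_funM; [exact: measurable_powR|exact: measurable_subr_powR].
have f_ge0 s : (0 <= f s)%R by rewrite mulr_ge0 ?powR_ge0.
rewrite (@ge0_integral_dilation t _ (EFin \o f))//; last 2 first.
- by apply/measurable_EFinP; exact: measurable_funTS.
- by move=> s _; rewrite lee_fin.
have -> : (fun x : R => t * x)%R @^-1` `[0%R, t] = `[0%R, 1%R]%classic.
  by apply/seteqP; split => x /=; rewrite !in_itv/= pmulr_rge0// ger_pMr.
pose g (u : R) := (u `^ a * (1 - u) `^ (b - 1))%R.
have mg : measurable_fun setT g.
  by apply: measurable_funM; [exact: measurable_powR|exact: measurable_subr_powR].
have g_ge0 u : (0 <= g u)%R by rewrite mulr_ge0 ?powR_ge0.
transitivity (t%:E * \int[mu]_(u in `[0%R, 1%R])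
    ((t `^ a * t `^ (b - 1))%:E * (g u)%:E)).
  congr (_ * _); apply: eq_integral => u; rewrite inE/= in_itv/= => /andP[u0 u1].
  rewrite /f -{2}[t]mulr1 -mulrBr !powRM ?subr_ge0// ?(ltW t0)// -EFinM /g.
  by congr EFin; ring.
rewrite ge0_integralZl//; last 3 first.
- by apply/measurable_EFinP; exact: measurable_funTS.
- by move=> u _; rewrite lee_fin.
- by rewrite lee_fin mulr_ge0 ?powR_ge0.
(* [Beta] is a real-valued integral, so finiteness must be shown: [u]^ a <=
   1[leaves the integrable bound](1 - u) [^ (b - 1)]. *)
have gE : \int[mu]_(u in `[0%R, 1%R]) (g u)%:E = (Beta (a + 1) b)%:E.
  rewrite /Beta/Rintegral addrK fineK// ge0_fin_numE; last first.
    by apply: integral_ge0 => u _; rewrite lee_fin g_ge0.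
  apply: le_lt_trans (integral_onem_powR_lty b0).
  apply: ge0_le_integral => //.
  - by move=> u _; rewrite lee_fin mulr_ge0 ?powR_ge0.
  - by apply/measurable_EFinP; exact: measurable_funTS.
  - apply/measurable_EFinP; apply: measurable_funTS.
    exact: measurable_subr_powR.
  - move=> u /=; rewrite in_itv/= => /andP[u0 u1]; rewrite lee_fin /g.
    rewrite ler_piMl ?powR_ge0// (_ : 1%R = 1 `^ a)%R; last by rewrite powR1.
    by rewrite ge0_ler_powR ?nnegrE.
rewrite gE -!EFinM mulrA; congr (_ * _)%:E.
have tn0 : t != 0%R by rewrite gt_eqF.
(* The Jacobian [t] counts as one more power: [a + 1 + (b - 1) = a + b]. *)
rewrite mulrCA -{2}(powRr1 (ltW t0)) -!powRD ?tn0 ?implybT//; congr (_ `^ _)%R.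
by ring.
Qed.

End beta_integral.

(** * Expectation of a time integral *)

Section ae_eq_nonmeasurable.
Context {d} {T : measurableType d} {R : realType}.
Variable mu : {measure set T -> \bar R}.
Local Open Scope ereal_scope.

Import HBNNSimple.

(* No measurability is required: a simple function below f stays below g once
   it is set to 0 on the null set where f and g may differ. *)
Lemma ge0_ae_eq_integral_nomeas (D : set T) (f g : T -> \bar R) :
  (forall x, D x -> 0 <= f x) -> (forall x, D x -> 0 <= g x) ->
  ae_eq mu D f g -> \int[mu]_(x in D) f x = \int[mu]_(x in D) g x.
Proof.
move=> f0 g0 [N [mN N0 fgN]].
have fg x : ~ N x -> (f \_ D) x = (g \_ D) x.
  move=> Nx; rewrite /patch; case: ifPn => // /set_mem Dx.
  by apply: contrapT => fgx; apply: Nx; apply: fgN => /= /(_ Dx).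
have ge0 (h : T -> \bar R) : (forall x, D x -> 0 <= h x) ->
    forall x, 0 <= (h \_ D) x.
  by move=> h0 x; rewrite /patch; case: ifPn => // /set_mem; exact: h0.
rewrite integral_mkcond [RHS]integral_mkcond.
suff le h1 h2 : (forall x, 0 <= h1 x) -> (forall x, 0 <= h2 x) ->
    (forall x, ~ N x -> h1 x = h2 x) -> \int[mu]_x h1 x <= \int[mu]_x h2 x.
  have [f0' g0'] := (ge0 _ f0, ge0 _ g0).
  by apply/eqP; rewrite eq_le !le// => x /fg.
move=> h10 h20 h12; rewrite !ge0_integralTE//.
apply: ge_ereal_sup => _ [s /= sh1 <-].
have mNc : measurable (~` N) by exact: measurableC.
pose s' := proj_nnsfun s mNc.
apply: le_ereal_sup_tmp; exists (sintegral mu s').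
  exists s' => //= x; rewrite mindicE in_setC.
  have [xN|xN] := boolP (x \in N); rewrite /= ?mulr0 ?mulr1 ?h20//.
  by rewrite -h12 ?sh1//; move/negP : xN => + /mem_set.
have sE (h : {nnsfun T >-> R}) : sintegral mu h = \int[mu]_x (h x)%:E.
  by rewrite integral_nnsfun// patch_setT.
rewrite !sE.
rewrite le_eqVlt; apply/orP; left; apply/eqP; apply: ae_eq_integral => //.
- by apply/measurable_EFinP; exact: measurable_funP.
- by apply/measurable_EFinP; exact: measurable_funP.
- exists N; split => // x /= H; apply: contrapT => Nx; apply: H => _.
  by rewrite mindicE in_setC memNset// mulr1.
Qed.

End ae_eq_nonmeasurable.

(** * Joint measurability and Tonelli's theorem for right continuous processes *)

Section right_continuous_process.
Context {d} {T : measurableType d} {R : realType}.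

(** The process is the pointwise limit of processes that are constant in time on each cell of the
    grid of mesh [1 / m.+1], where they take the value of [X] at the right end of the cell. *)
Lemma measurable_right_continuous (X : R -> T -> R) :
  (forall s, 0 <= s -> measurable_fun [set: T] (X s)) ->
  (forall w s, 0 <= s -> X r w @[r --> s^'+] --> X s w) ->
  measurable_fun ((`[0, +oo[%classic : set (measurableTypeR R)) `*` [set: T])
    (fun z : measurableTypeR R * T => X z.1 z.2).
Proof.
move=> mX rX.
(* The grid point lies strictly above [s], even when [s] is itself on the grid, so the limit is
   taken along [s^'+]. *)
pose u (m : nat) (s : R) : R := (Num.truncn (s * m.+1%:R)).+1%:R / m.+1%:R.
apply: (@measurable_fun_cvg _ _ _ _ (fun m z => X (u m z.1) z.2)); last first.
  move=> [s w] [/= + _]; rewrite in_itv/= andbT => s0.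
  have us m : s < u m s <= s + m.+1%:R^-1.
    have sm0 : 0 <= s * m.+1%:R by rewrite mulr_ge0.
    have /andP[h1 h2] := truncn_itv sm0.
    rewrite /u ltr_pdivlMr// h2/= ler_pdivrMr// mulrDl mulVf ?pnatr_eq0//.
    by rewrite -natr1 lerD2r.
  have /cvg_at_rightP := rX w s s0; apply; split.
    by move=> m; have /andP[] := us m.
  apply: (@squeeze_cvgr _ _ _ _ (cst s) (fun m => s + m.+1%:R^-1)).
  - by apply: nearW => m; have /andP[/ltW -> ->] := us m.
  - exact: cvg_cst.
  - rewrite -[X in _ --> X]addr0; apply: cvgD; first exact: cvg_cst.
    exact: cvg_harmonic.
move=> m mD Y mY.
(* The preimage is a countable union of rectangles, one per cell. *)
rewrite [X in measurable X](_ : _ = \bigcup_j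
    ((`[j%:R / m.+1%:R, j.+1%:R / m.+1%:R[%classic : set (measurableTypeR R)) `*`
      (X (j.+1%:R / m.+1%:R) @^-1` Y))).
  apply: bigcupT_measurable => j; apply: measurableX; first exact: measurable_itv.
  by rewrite -[_ @^-1` _]setTI; apply: mX => //; rewrite divr_ge0.
have uE (s : R) j : j%:R / m.+1%:R <= s < j.+1%:R / m.+1%:R ->
    u m s = j.+1%:R / m.+1%:R.
  rewrite ler_pdivrMr// ltr_pdivlMr// /u => sj.
  by rewrite (@Num.Theory.truncn_def _ _ j).
apply/seteqP; split => [[s w] [[/= + _] Yw]|[s w] [j _ [/= sj Yw]]].
  rewrite in_itv/= andbT => s0; exists (Num.truncn (s * m.+1%:R)) => //.
  split => //=; rewrite in_itv/= ler_pdivrMr// ltr_pdivlMr//.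
  by apply: truncn_itv; rewrite mulr_ge0.
rewrite in_itv/= in sj; split; last by rewrite /= (uE _ _ sj).
split => //=; rewrite in_itv/= andbT.
by move: sj => /andP[+ _]; apply: le_trans; rewrite divr_ge0.
Qed.

Local Open Scope ereal_scope.

(** Tonelli's theorem for a process whose paths are right continuous only almost surely. The
    finiteness assumption is what lets the real-valued time integral on the left be compared with an
    extended one. *)
Lemma integral_time_integral (P : probability T R) (X : R -> T -> R)
    (phi : R -> R) (c t : R) (B : set T) :
  (0 <= c)%R -> measurable B -> measurable_fun setT phi -> (forall s, (0 <= phi s)%R) ->
  (forall s, (0 <= s)%R -> measurable_fun [set: T] (X s)) ->
  (forall s w, (0 <= X s w)%R) ->
  {ae P, forall w, forall s, (0 <= s)%R -> X r w @[r --> s^'+] --> X s w} ->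
  \int[lebesgue_measure]_(s in `[0%R, t])
    ((phi s)%:E * \int[P]_(w in B) (X s w)%:E) < +oo ->
  \int[P]_(w in B)
    (c * \int[lebesgue_measure]_(s in `[0%R, t]) (phi s * X s w))%:E =
  c%:E * \int[lebesgue_measure]_(s in `[0%R, t])
    ((phi s)%:E * \int[P]_(w in B) (X s w)%:E).
Proof.
move=> c0 mB mphi phi0 mX X0 [N [mN N0 XN]].
(* Setting the bad paths to 0 makes every path right continuous, hence [Y] jointly measurable. *)
pose Y s w := (X s w * \1_(~` N) w)%R.
have mNc : measurable (~` N) by exact: measurableC.
have mY s : (0 <= s)%R -> measurable_fun [set: T] (Y s).
  by move=> s0; apply: measurable_funM => //; exact: mX.
have Y0 s w : (0 <= Y s w)%R by rewrite mulr_ge0.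
have YX s w : ~ N w -> Y s w = X s w.
  by move=> Nw; rewrite /Y indicE mem_set// mulr1.
have rY w s : (0 <= s)%R -> Y r w @[r --> s^'+] --> Y s w.
  move=> s0; have [Nw|Nw] := pselect (N w).
    rewrite /Y indicE in_setC mem_set//= mulr0.
    by under eq_fun do rewrite mulr0; exact: cvg_cst.
  under eq_fun do rewrite YX//; rewrite YX//.
  by have := contrapT (contra_not (XN w) Nw); apply.
have := measurable_right_continuous mY rY => mYz.
pose D := (`[0%R, t]%classic : set (measurableTypeR R)) `*` B.
pose G (z : measurableTypeR R * T) := (phi z.1 * Y z.1 z.2)%:E.
have mD : measurable D by apply: measurableX.
have mG : measurable_fun setT (G \_ D).
  apply/(measurable_restrictT _ _).1 => //; apply/measurable_EFinP.
  apply: measurable_funM.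
    apply: measurable_funTS; apply: (measurableT_comp mphi); exact: measurable_fst.
  apply: measurable_funS mYz; first exact: measurableX.
  by move=> [s w] [/=]; rewrite !in_itv/= => /andP[->].
have G0 z : 0 <= (G \_ D) z.
  by rewrite /patch; case: ifPn => // _; rewrite lee_fin mulr_ge0.
have KY s : (0 <= s)%R ->
    \int[P]_(w in B) (phi s * Y s w)%:E = (phi s)%:E * \int[P]_(w in B) (X s w)%:E.
  move=> s0; under eq_integral do rewrite EFinM.
  rewrite ge0_integralZl//; last 3 first.
  - by apply/measurable_EFinP; apply: measurable_funTS; exact: mY.
  - by move=> w _; rewrite lee_fin.
  - by rewrite lee_fin.
  congr (_ * _); apply: ge0_ae_eq_integral_nomeas.
  - by move=> w _; rewrite lee_fin.
  - by move=> w _; rewrite lee_fin.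
  - exists N; split => // w /= H; apply: contrapT => Nw; apply: H => _.
    by rewrite YX.
have FE : \int[lebesgue_measure]_s \int[P]_w (G \_ D) (s, w) =
    \int[lebesgue_measure]_(s in `[0%R, t])
      ((phi s)%:E * \int[P]_(w in B) (X s w)%:E).
  rewrite [RHS]integral_mkcond; apply: eq_integral => s _.
  rewrite [in RHS]/patch; case: ifPn => [/set_mem/= st|st].
    move: (st); rewrite in_itv/= => /andP[s0 _].
    rewrite -KY// [RHS]integral_mkcond; apply: eq_integral => w _.
    rewrite /patch; have [wB|wB] := boolP (w \in B).
      by rewrite ifT// inE; split=> //=; exact/set_mem.
    by rewrite ifF//; apply/negbTE; apply: contra wB; rewrite !inE => -[].
  apply: integral0_eq => w _; rewrite /patch ifF//; apply/negbTE.
  by apply: contra st; rewrite !inE => -[].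
pose H w := \int[lebesgue_measure]_s (G \_ D) (s, w).
have mH : measurable_fun setT H by exact: measurable_fun_fubini_tonelli_G.
have H0 w : 0 <= H w by exact: integral_ge0.
have HE : \int[P]_w H w = \int[lebesgue_measure]_(s in `[0%R, t])
      ((phi s)%:E * \int[P]_(w in B) (X s w)%:E).
  by rewrite -FE; apply/esym; exact: fubini_tonelli.
(* A finite expectation makes [H] finite almost surely, so [fine] in the real-valued integral loses
   nothing. *)
rewrite -HE => Hoo.
have iH : P.-integrable setT H.
  apply/integrableP; split => //.
  by under eq_integral do rewrite gee0_abs//.
have Hfin_ae := integrable_ae measurableT iH.
have -> : \int[P]_w H w = \int[P]_(w in B) H w.
  rewrite [RHS]integral_mkcond; apply: eq_integral => w _.
  rewrite /patch; case: ifPn => // wB; apply: integral0_eq => s _.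
  by rewrite /patch ifF//; apply/negbTE; apply: contra wB; rewrite !inE => -[].
rewrite -ge0_integralZl//; last exact: measurable_funTS.
(* The time integral of [X] is known to agree with that of [Y] only off [N], and its measurability
   in [w] is not established. *)
apply: ge0_ae_eq_integral_nomeas => //.
- move=> w _; rewrite lee_fin; apply: mulr_ge0 => //.
  by apply: Rintegral_ge0 => s _; exact: mulr_ge0.
- by move=> w _; apply: mule_ge0; rewrite ?lee_fin.
have Nae : {ae P, forall w, ~ N w} by exists N; split => // w /= /contrapT.
apply: filterS2 Nae Hfin_ae => w Nw /(_ Logic.I) Hfin Bw.
rewrite -(fineK Hfin) -EFinM /Rintegral; congr (c * fine _)%:E.
rewrite integral_mkcond; apply: eq_integral => s _.
rewrite /patch; have [st|st] := boolP (s \in `[0%R, t]%classic).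
  by rewrite ifT /G ?YX// inE; split => //=; exact/set_mem.
by rewrite ifF//; apply/negbTE; apply: contra st; rewrite !inE => -[].
Qed.

End right_continuous_process.

(** * The conditional expectation *)

Section ge0_integral_value.
Context {R : realType}.
Notation mu := (@lebesgue_measure R).

(** Measurability and sign travel together with the value, so that nested sums can be integrated
    term by term. *)
Definition ge0_integral_value (D : set R) (f : R -> R) (v : R) : Prop :=
  [/\ measurable_fun setT f, forall s, 0 <= f s &
      (\int[mu]_(s in D) (f s)%:E = v%:E)%E].

Lemma ge0_integral_valueZ (D : set R) f v c : measurable D -> 0 <= c ->
  ge0_integral_value D f v ->
  ge0_integral_value D (fun s => c * f s) (c * v).
Proof.
move=> mD c0 [mf f0 fv]; split; first exact: measurable_funM.
  by move=> s; exact: mulr_ge0.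
under eq_integral do rewrite EFinM.
rewrite ge0_integralZl//; first by rewrite fv EFinM.
- by apply/measurable_EFinP; exact: measurable_funTS.
- by move=> s _; rewrite lee_fin.
Qed.

Lemma ge0_integral_value_fsum (D : set R) (I : choiceType) (A : set I) f v :
  measurable D -> finite_set A ->
  (forall i, ge0_integral_value D (f i) (v i)) ->
  ge0_integral_value D (fun s => \sum_(i \in A) f i s) (\sum_(i \in A) v i).
Proof.
move=> mD fA fv; have mf i : measurable_fun setT (f i) by have [] := fv i.
have f0 i s : 0 <= f i s by have [] := fv i.
split.
- under eq_fun do rewrite fsbig_finite//.
  exact: measurable_sum.
- by move=> s; apply: fsumr_ge0.
- under eq_integral do rewrite -fsumEFin//.
  rewrite ge0_integral_fsum//; last 2 first.
  + move=> i; apply/measurable_EFinP; apply: measurable_funTS; exact: mf.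
  + by move=> i s _; rewrite lee_fin.
  by rewrite -fsumEFin//; apply: eq_fsbigr => i _; have [] := fv i.
Qed.

End ge0_integral_value.

(** * Integration of the bridge expectation against the fractional kernel *)

Section bridge_integral.
Context {R : realType} {k : nat} (lam : 'I_k -> R).
Hypothesis lam_ge0 : forall i, 0 <= lam i.
Notation mu := (@lebesgue_measure R).

Let W (y : {ffun 'I_k -> nat}) : R := \prod_(j < k) (lam j ^+ y j / (y j)`!%:R).
Let N (y : {ffun 'I_k -> nat}) : R := (\sum_(j < k) y j)%N%:R.

Let W_ge0 y : 0 <= W y.
Proof. by apply: prodr_ge0 => j _; rewrite divr_ge0// exprn_ge0. Qed.

(** Real exponents prepare for merging the powers of time with the exponent [alpha - 1] of the
    kernel. *)
Lemma gcp_pmf_powR s m : 0 <= s ->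
  gcp_pmf lam s m =
  expR (- (total_rate lam * s)) * \sum_(y \in Omega k m) (W y * s `^ N y).
Proof.
move=> s0; congr (_ * _); apply: eq_fsbigr => y _.
rewrite /N powR_mulrn// -prodrXr /W -big_split/=; apply: eq_bigr => j _.
by rewrite exprMn mulrAC.
Qed.

Let bridge (alpha t : R) (n r : nat) (s : R) : R :=
  \sum_(y \in Omega k r) \sum_(z \in Omega k (n - r))
    W y * W z * (s `^ N y * (t - s) `^ (alpha + N z - 1)).

(** The two exponentials multiply to one that is free of [s], and as [t - s] is nonzero the kernel
    merges with its powers; what remains is a combination of beta integrands. *)
Lemma bridge_integrand (alpha t s : R) n : 0 < s < t ->
  (t - s) `^ (alpha - 1) *
    \sum_(r < n.+1) r%:R * (gcp_pmf lam s r * gcp_pmf lam (t - s) (n - r)) =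
  \sum_(r \in `I_n.+1)
    r%:R * expR (- (total_rate lam * t)) * bridge alpha t n r s.
Proof.
move=> /andP[s0 st]; have ts0 : 0 < t - s by rewrite subr_gt0.
rewrite mulr_sumr -fsbig_ord; apply: eq_bigr => r _.
rewrite !gcp_pmf_powR ?ltW//.
have -> : expR (- (total_rate lam * t)) =
    expR (- (total_rate lam * s)) * expR (- (total_rate lam * (t - s))).
  by rewrite -expRD -opprD -mulrDr addrC subrK.
have -> : bridge alpha t n r s = (t - s) `^ (alpha - 1) *
    ((\sum_(y \in Omega k r) (W y * s `^ N y)) *
     (\sum_(z \in Omega k (n - r)) (W z * (t - s) `^ N z))).
  rewrite mulr_fsuml mulr_fsumr; apply: eq_fsbigr => y _.
  rewrite !mulr_fsumr; apply: eq_fsbigr => z _.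
  rewrite (addrAC alpha) [X in _ * (_ * X) = _]powRD; last by rewrite (gt_eqF ts0) implybT.
  by ring.
by ring.
Qed.

(** Each term is a scaled beta integral with [a = N y] and [b = alpha + N z], the latter positive
    because [alpha] is. *)
Lemma bridge_integral (alpha t : R) n : 0 < alpha -> 0 < t ->
  ge0_integral_value `[0, t]
    (fun s => \sum_(r \in `I_n.+1)
      r%:R * expR (- (total_rate lam * t)) * bridge alpha t n r s)
    (\sum_(r \in `I_n.+1) r%:R * expR (- (total_rate lam * t)) *
      \sum_(y \in Omega k r) \sum_(z \in Omega k (n - r))
        W y * W z *
        (t `^ (N y + (alpha + N z)) * Beta (N y + 1) (alpha + N z))).
Proof.
move=> alpha0 t0.
apply: ge0_integral_value_fsum => [//|//|r].
apply: ge0_integral_valueZ => //.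
apply: ge0_integral_value_fsum => [//||y]; first exact: finite_Omega.
apply: ge0_integral_value_fsum => [//||z]; first exact: finite_Omega.
apply: ge0_integral_valueZ => //; first exact: mulr_ge0.
split.
- by apply: measurable_funM; [exact: measurable_powR|exact: measurable_subr_powR].
- by move=> s; rewrite mulr_ge0 ?powR_ge0.
- by apply: integral_beta_scaled => //; rewrite ?ler0n// ltr_pwDl.
Qed.

End bridge_integral.

Unset Implicit Arguments.

Theorem proposition6p1 (R : realType) (d : measure_display)
    (T : measurableType d) (P : probability T R)
    (k : nat) (k_ge1 : (1 <= k)%N)
    (lam : 'I_k -> R) (lam_gt0 : forall i, 0 < lam i)
    (M : R -> {RV P >-> nat}) (M_GCP : GCP lam M)
    (alpha : R) (alpha_gt0 : 0 < alpha)
    (t : R) (t_gt0 : 0 < t) (n : nat) :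
  cond_expectation P (fractional_integral alpha M t) (M t @^-1` [set n]) =
  ((Gamma alpha)^-1 *
   \sum_(0 <= r < n.+1)
     r%:R * expR (- (total_rate lam * t)) / fine (P (M t @^-1` [set n])) *
     \sum_(y \in Omega k r)
       (\prod_(j < k) (lam j ^+ y j / (y j)`!%:R)) *
       \sum_(z \in Omega k (n - r))
         (\prod_(j < k) (lam j ^+ z j / (z j)`!%:R)) *
         (let sy : R := (\sum_(j < k) y j)%N%:R in
          let sz : R := (\sum_(j < k) z j)%N%:R in
          t `^ (sy + alpha + sz) * Beta (sy + 1) (alpha + sz)))%:E.
Proof.
have lam_ge0 i : 0 <= lam i by exact/ltW.
have [_ val_ge0 valE] := bridge_integral lam_ge0 n alpha_gt0 t_gt0.
set v := (X in _ = X%:E) in valE.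
pose f s := (t - s) `^ (alpha - 1).
have f_ge0 s : 0 <= f s by exact: powR_ge0.
have fv : (\int[lebesgue_measure]_(s in `[0%R, t])
    ((f s)%:E * \int[P]_(w in M t @^-1` [set n]) ((M s w)%:R)%:E) = v%:E)%E.
  (* The explicit integrand is available for [0 < s < t] only; the two endpoints form a null set. *)
  rewrite -valE; apply: ge0_ae_eq_integral_nomeas.
  - move=> s _; rewrite mule_ge0 ?lee_fin//.
    by apply: integral_ge0 => w _; rewrite lee_fin.
  - by move=> s _; rewrite lee_fin val_ge0.
  - exists [set 0; t]; split.
    + exact: measurableU.
    + by apply: countable_lebesgue_measure0; exact/finite_set_countable/finite_set2.
    + move=> s /= /not_implyP[]; rewrite in_itv/= => /andP[s0 st] H.
      apply: contrapT => /not_orP[/eqP sn0 /eqP snt]; apply: H.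
      have sst : 0 < s < t by rewrite !lt_neqAle s0 st eq_sym sn0 snt.
      by rewrite (expectation_gcp_bridge M_GCP lam_ge0)// -EFinM bridge_integrand.
have Gamma_ge0 : 0 <= (Gamma alpha)^-1.
  by rewrite invr_ge0; apply: Rintegral_ge0 => x _; rewrite mulr_ge0 ?powR_ge0 ?expR_ge0.
rewrite /cond_expectation.
rewrite (@integral_time_integral _ _ _ P (fun s w => (M s w)%:R) f)//; last 5 first.
- exact: measurable_gcp_preimage.
- exact: measurable_subr_powR.
- by move=> s _; apply: measurableT_comp.
- have := Levy_cadlag (GCP_Levy M_GCP).
  by apply: filterS => w [+ _] s s0; apply.
(* The computed value [v] is real, which supplies the finiteness required for the exchange. *)
- by rewrite [ltLHS]fv ltry.
rewrite fv -!EFinM; congr EFin.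
rewrite mulrCA; congr (_ * _); rewrite /v -fsbig_ord mulr_sumr big_mkord.
apply: eq_bigr => r _.
rewrite mulrA [_^-1 * _]mulrC; congr (_ * _).
apply: eq_fsbigr => y _; rewrite mulr_fsumr; apply: eq_fsbigr => z _.
by rewrite -mulrA addrA.
Qed.
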